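(* Consider Neumann boundary conditions on $\partial\Omega$. Let $\gamma=1$ for the iterative IMEX-E Euler method and $\gamma=\frac32$ for the iterative IMEX-E 2SBDF method. Let $h=\min\{\Delta x,\Delta y\}$ and assume that the steps satisfy $$\frac{\Delta tD_\phi}{\gamma+w\Delta t}\left(\frac1{\Delta x^2}+\frac1{\Delta y^2}\right)<1,\qquad\frac{\Delta tD_c}{\gamma}\left(\frac1{\Delta x^2}+\frac1{\Delta y^2}\right)<1.$$ The iterations defining the iterative IMEX-E Euler method, and the iterations defining the iterative IMEX-E 2SBDF method, converge provided that $$\left(h^2>\frac{(1+\sqrt{41})D_\phi}{w}\quad\text{or}\quad\Delta t<\frac{\gamma(\sqrt{41}-1)h^2}{40D_\phi+2wh^2}\right)\quad\text{and}\quad\Delta t<\frac{\gamma(\sqrt{41}-1)h^2}{40D_c}.$$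
   Context: Let $\Omega=[0,L_x]\times[0,L_y]$, let $\Theta$ be a set contained in the interior of $\Omega$ (the union of the holes), and $\widehat\Omega=\Omega\setminus\Theta$. The grid is uniform with $m_x\times m_y$ nodes ($m_x,m_y\ge2$), including the boundary nodes: $(x_i,y_j)=((i-1)\Delta x,(j-1)\Delta y)$, $1\le i\le m_x$, $1\le j\le m_y$, $\Delta x=L_x/(m_x-1)$, $\Delta y=L_y/(m_y-1)$, ordered lexicographically (index $i+(j-1)m_x$); $\Theta$ contains at least one grid node. The discrete Neumann Laplacian is $\mathcal M=I_{m_y}\otimes\mathcal M_x+\mathcal M_y\otimes I_{m_x}$, where for $r\in\{x,y\}$ the $m_r\times m_r$ matrix $\mathcal M_r$ is $\frac1{\Delta r^2}$ times the tridiagonal matrix with $-2$ on the diagonal and $1$ on the sub- and superdiagonal, except that the entries in positions $(1,2)$ and $(m_r,m_r-1)$ are $2$. The matrix $\mathcal N_1$ has entries $(\mathcal N_1)_{p,q}=\mathcal M_{p,q}$ if node $p$ is in $\Theta$ and node $q$ is in $\widehat\Omega$, and $0$ otherwise. The constants $D_\phi,D_c,w,\Delta t$ are positive. For the IMEX-E methods put $\mathcal N=\mathcal N_1$. At each time step the iterative Euler method consists of the two iterations in $k=0,1,2,\dots$ $$((1+w\Delta t)I-\Delta tD_\phi\mathcal M)\boldsymbol\phi^{n+1,k+1}=-\Delta tD_\phi\mathcal N\boldsymbol\phi^{n+1,k}+\mathbf g_\phi,\qquad (I-\Delta tD_c\mathcal M)\mathbf c^{n+1,k+1}=-\Delta tD_c\mathcal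 N\mathbf c^{n+1,k}+\mathbf g_c,$$ and the iterative 2SBDF method of the two iterations $$((3+2w\Delta t)I-2\Delta tD_\phi\mathcal M)\boldsymbol\phi^{n+2,k+1}=-2\Delta tD_\phi\mathcal N\boldsymbol\phi^{n+2,k}+\mathbf g_\phi,\qquad (3I-2\Delta tD_c\mathcal M)\mathbf c^{n+2,k+1}=-2\Delta tD_c\mathcal N\mathbf c^{n+2,k}+\mathbf g_c,$$ where $\mathbf g_\phi,\mathbf g_c$ are known vectors built from already computed quantities and independent of $k$. Convergence means convergence of the sequences as $k\to\infty$ for every starting iterate. *)

(* Defs.v *)
From HB Require Import structures.
From mathcomp Require Export all_boot all_order all_algebra.
From mathcomp Require Export all_classical all_reals all_analysis.
From mathcomp Require Export mxtens.

Set Implicit Arguments.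
Unset Strict Implicit.
Unset Printing Implicit Defensive.

Import Order.TTheory GRing.Theory Num.Theory.
Import numFieldNormedType.Exports.

Local Open Scope classical_set_scope.
Local Open Scope ring_scope.

Definition domain (R : realType) (Lx Ly : R) : set (R * R) :=
  `[0, Lx] `*` `[0, Ly].

Definition step (R : realType) (L : R) (m : nat) : R := L / m.-1%:R.

(* Unknowns are indexed by 'I_(my * mx).  With 0-based ordinals, p stands for
   the pair (j, i) such that p = j * mx + i, where i < mx is the x-index and
   j < my the y-index: this is the lexicographic order (x running fastest),
   and also the indexing convention of the Kronecker product  *t. *)
Definition grid_node (R : realType) (Lx Ly : R) (mx my : nat)
    (p : 'I_(my * mx)) : R * R :=
  let ji := mxtens_unindex p in
  (ji.2%:R * step Lx mx, ji.1%:R * step Ly my).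

(* Second-difference matrix; eliminating the ghost nodes of the centred Neumann
   condition doubles the off-diagonal entry of the first and last rows. *)
Definition neumann1 (R : realType) (m : nat) (d : R) : 'M[R]_m :=
  (d ^+ 2)^-1 *: \matrix_(i < m, j < m)
    (if i == j then -2
     else if ((i == 0 :> nat) && (j == 1 :> nat))
          || ((i.+1 == m) && (j.+2 == m)) then 2
     else if (i.+1 == j) || (j.+1 == i) then 1
     else 0).

Definition neumann_laplacian (R : realType) (Lx Ly : R) (mx my : nat) :
    'M[R]_(my * mx) :=
  ((1%:M : 'M[R]_my) *t neumann1 mx (step Lx mx)) +
  (neumann1 my (step Ly my) *t (1%:M : 'M[R]_mx)).

Definition hole_mx1 (R : realType) (Lx Ly : R) (mx my : nat)
    (Theta : set (R * R)) : 'M[R]_(my * mx) :=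
  \matrix_(p, q)
    (if (grid_node Lx Ly p \in Theta)
        && (grid_node Lx Ly q \in domain Lx Ly `\` Theta)
     then neumann_laplacian Lx Ly mx my p q else 0).

Inductive imex_method := Euler | SBDF2.

Definition gamma (R : realType) (meth : imex_method) : R :=
  match meth with Euler => 1 | SBDF2 => 3 / 2 end.

Definition phi_lhs (R : realType) (n : nat) (meth : imex_method)
    (w dt Dphi : R) (M : 'M[R]_n) : 'M[R]_n :=
  match meth with
  | Euler => (1 + w * dt) *: 1%:M - (dt * Dphi) *: M
  | SBDF2 => (3 + 2 * w * dt) *: 1%:M - (2 * dt * Dphi) *: M
  end.

Definition c_lhs (R : realType) (n : nat) (meth : imex_method)
    (dt Dc : R) (M : 'M[R]_n) : 'M[R]_n :=
  match meth with
  | Euler => 1%:M - (dt * Dc) *: M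
  | SBDF2 => 3 *: 1%:M - (2 * dt * Dc) *: M
  end.

Definition rhs (R : realType) (n : nat) (meth : imex_method)
    (dt D : R) (N : 'M[R]_n) : 'M[R]_n :=
  match meth with
  | Euler => - (dt * D) *: N
  | SBDF2 => - (2 * dt * D) *: N
  end.

Definition iterates (R : realType) (n : nat) (A B : 'M[R]_n)
    (g u0 : 'cV[R]_n) (u : nat -> 'cV[R]_n) : Prop :=
  u 0%N = u0 /\ forall k, A *m u k.+1 = B *m u k + g.

(* The first conjunct says that the implicit iteration is well defined, so that
   the second one cannot hold vacuously. *)
Definition iteration_converges (R : realType) (n : nat) (A B : 'M[R]_n) :
    Prop :=
  forall g u0 : 'cV[R]_n,
    (exists! u, iterates A B g u0 u) /\
    (forall u, iterates A B g u0 u -> exists l : 'cV[R]_n, u @ \oo --> l).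

Definition imex_iterations_converge (R : realType) (n : nat)
    (meth : imex_method) (w dt Dphi Dc : R) (M N : 'M[R]_n) : Prop :=
  iteration_converges (phi_lhs meth w dt Dphi M) (rhs meth dt Dphi N) /\
  iteration_converges (c_lhs meth dt Dc M) (rhs meth dt Dc N).

(* Main.v *)
Require Import Defs.
From mathcomp Require Import ring lra.

Set Implicit Arguments.
Unset Strict Implicit.
Unset Printing Implicit Defensive.

Import Order.TTheory GRing.Theory Num.Theory.
Import numFieldNormedType.Exports.

Local Open Scope classical_set_scope.
Local Open Scope ring_scope.

(** Both iterations have the form A u' = B u + g with A = a I - b M and
    B = - b N, where M is the Neumann Laplacian, N a part of its off-diagonal
    entries, b = dt D up to the factor 2 of the BDF scheme, and a = gamma + w dt
    for phi, a = gamma for c, up to the same factor.  They contract in the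
    max norm.

    Put S = 2 / dx^2 + 2 / dy^2.  Each diagonal entry of M is - S, and the
    absolute values of the other entries of a row add up to at most S, on the
    boundary as well since the doubled Neumann entry stands in for the missing
    neighbour ([laplacian_diag], [laplacian_offdiag_le]).  Hence A exceeds
    diagonal dominance by a in each row, while a row of B has absolute sum at
    most b S: the diagonal of M never enters N, because no node is both inside
    and outside the holes.  Looking at A x = B y in a row where |x| is largest
    gives a |x| <= b S |y| ([dominant_solution_le]).  When b S < a this bound
    makes A and A - B injective, so the iterates are well defined and have a
    fixed point, and it shows that the distance to that fixed point decays at
    least like (b S / a)^k ([dominant_iteration_converges]).

    It remains to see that b S < a.  With h = min(dx, dy), S <= 4 / h^2, so
    dt D / a < h^2 / 4 is enough.  As 40 = (sqrt 41 - 1) (sqrt 41 + 1), either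
    alternative for phi bounds dt D / a by (sqrt 41 - 1) / 40 h^2, and so does
    the condition for c; finally (sqrt 41 - 1) / 40 is about 0.135, which is
    less than 1 / 4 ([reaction_step_small], [diffusion_step_small]). *)

(** * Iterations with a dominant implicit matrix *)

Lemma unitmx_ker0 (F : fieldType) (n : nat) (A : 'M[F]_n) :
  (forall x : 'cV[F]_n, A *m x = 0 -> x = 0) -> A \in unitmx.
Proof.
move=> kerA; rewrite -unitmx_tr -row_free_unit; apply: inj_row_free => v vA0.
apply: trmx_inj; rewrite trmx0; apply: kerA.
by rewrite -[A]trmxK -trmx_mul vA0 trmx0.
Qed.

Lemma col_entry_le_norm (R : realType) (n : nat) (x : 'cV[R]_n) (p : 'I_n) :
  `|x p 0| <= `|x|.
Proof.
rewrite -[leRHS]/(mx_norm x) mx_normrE; apply/bigmax_geP; right.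
by exists (p, 0).
Qed.

Lemma col_norm_attained (R : realType) (n : nat) (x : 'cV[R]_n) :
  x != 0 -> exists p, `|x| = `|x p 0|.
Proof.
move=> x0.
have /mx_norm_neq0[[p j] /= e] : mx_norm x != 0.
  by apply: contra_neq x0; exact: mx_norm_eq0.
by exists p; rewrite [LHS]e (ord1 j).
Qed.

(** In the row p where |x| is attained, the off-diagonal terms of A x can undo
    only the part sum |A p q| of the diagonal one, so an excess of a |x|
    remains, and it has to be matched by B y. *)
Lemma dominant_solution_le (R : realType) (n : nat) (A B : 'M[R]_n) (a b : R)
    (x y : 'cV[R]_n) :
  (forall p, a + \sum_(q | q != p) `|A p q| <= `|A p p|) ->
  (forall p, \sum_q `|B p q| <= b) -> 0 <= b ->
  A *m x = B *m y -> a * `|x| <= b * `|y|.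
Proof.
move=> domA rowB b0 AxBy.
have [->|/col_norm_attained[p xp]] := eqVneq x 0.
  by rewrite normr0 mulr0 mulr_ge0.
have diag : A p p * x p 0 =
    (\sum_q B p q * y q 0) - \sum_(q | q != p) A p q * x q 0.
  move/matrixP: AxBy => /(_ p 0); rewrite !mxE => <-.
  by rewrite (bigD1 p)//= addrK.
have By : `|\sum_q B p q * y q 0| <= b * `|y|.
  apply: le_trans (ler_wpM2r _ (rowB p)) => //.
  rewrite mulr_suml; apply: le_trans (ler_norm_sum _ _ _) _.
  by apply: ler_sum => q _; rewrite normrM ler_wpM2l// col_entry_le_norm.
have Ax : `|\sum_(q | q != p) A p q * x q 0|
    <= (\sum_(q | q != p) `|A p q|) * `|x|.
  rewrite mulr_suml; apply: le_trans (ler_norm_sum _ _ _) _.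
  by apply: ler_sum => q _; rewrite normrM ler_wpM2l// col_entry_le_norm.
have : `|A p p| * `|x| <= b * `|y| + (\sum_(q | q != p) `|A p q|) * `|x|.
  rewrite {1}xp -normrM diag.
  by apply: le_trans (ler_normB _ _) _; exact: lerD.
have := ler_wpM2r (normr_ge0 x) (domA p).
rewrite mulrDl; lra.
Qed.

(** The limit is the solution l of (A - B) l = g.  Since A (u k.+1 - l) =
    B (u k - l), the error shrinks by b / a at each step; having l beforehand
    replaces a Cauchy argument. *)
Lemma dominant_iteration_converges (R : realType) (n : nat) (A B : 'M[R]_n)
    (a b : R) :
  (forall p, a + \sum_(q | q != p) `|A p q| <= `|A p p|) ->
  (forall p, \sum_q `|B p q| <= b) -> 0 <= b -> b < a ->
  iteration_converges A B.
Proof.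
move=> domA rowB b0 ba g u0; have a0 : 0 < a by exact: le_lt_trans ba.
have contr (x y : 'cV[R]_n) : A *m x = B *m y -> a * `|x| <= b * `|y|.
  exact: dominant_solution_le.
have Au : A \in unitmx.
  apply: unitmx_ker0 => x Ax; have := contr x 0.
  rewrite Ax mulmx0 normr0 mulr0 => /(_ erefl).
  by rewrite pmulr_rle0// normr_le0 => /eqP.
have ABu : A - B \in unitmx.
  apply: unitmx_ker0 => x; rewrite mulmxBl => /eqP; rewrite subr_eq0 => /eqP.
  move=> /contr; rewrite -subr_le0 -mulrBl pmulr_rle0 ?subr_gt0//.
  by rewrite normr_le0 => /eqP.
split.
  exists (fun k => iter k (fun v => invmx A *m (B *m v + g)) u0); split.
    by split=> // k; rewrite iterS mulmxA mulmxV// mul1mx.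
  move=> v [v0 vS]; apply/funext; elim=> [|k IHk]; first by rewrite v0.
  by rewrite iterS IHk -vS mulmxA mulVmx// mul1mx.
move=> u [_ uS]; pose l := invmx (A - B) *m g; exists l.
have fixl : A *m l = B *m l + g.
  by apply/eqP; rewrite addrC -subr_eq -mulmxBl mulmxA mulmxV// mul1mx.
have q1 : `|b / a| < 1.
  by rewrite ger0_norm ?(divr_ge0 b0 (ltW a0))// ltr_pdivrMr// mul1r.
have err k : `|u k - l| <= geometric `|u 0%N - l| (b / a) k.
  elim: k => [|k IHk]; first by rewrite /= expr0 mulr1.
  have : a * `|u k.+1 - l| <= b * `|u k - l|.
    by apply: contr; rewrite !mulmxBr uS fixl opprD addrACA subrr addr0.
  rewrite mulrC -ler_pdivlMr// => /le_trans; apply.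
  by rewrite mulrAC /= exprS mulrCA ler_wpM2l// divr_ge0// ltW.
apply: cvg_sub0 (cvg_cst l); apply/norm_cvg0P.
apply: squeeze_cvgr (cvg_cst 0) (cvg_geometric `|u 0%N - l| q1).
by near=> k; rewrite normr_ge0 err.
Unshelve. all: by end_near.
Qed.

(** * Row sums of the Neumann Laplacian *)

Lemma sum_ord_eqn (R : pzSemiRingType) (m k : nat) :
  \sum_(j < m) ((k == j)%:R : R) = (k < m)%:R.
Proof.
rewrite -natr_sum; congr _%:R.
rewrite -(@big_mkcond nat 0%N addn 'I_m _ (fun j => k == j) (fun=> 1%N)).
under eq_bigl do rewrite eq_sym.
by rewrite (big_ord1_eq _ (fun=> 1%N)); case: ifP.
Qed.

Lemma neumann1_diag (R : realType) (m : nat) (d : R) (i : 'I_m) :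
  neumann1 m d i i = - (2 / d ^+ 2).
Proof. by rewrite !mxE eqxx mulrN mulrC. Qed.

(** For m >= 2 the entries of a row, times d^2, have absolute sum 2 + 1 + 1, or
    2 + 2 at an end of the grid, where one neighbour is missing and the other
    one counts twice. *)
Lemma neumann1_row_le (R : realType) (m : nat) (d : R) (i : 'I_m) :
  \sum_j `|neumann1 m d i j| <= 4 / d ^+ 2.
Proof.
pose c b : R := if b then 2 else 1.
have c1 b : 1 <= c b by rewrite /c; case: b; lra.
have c0 b : 0 <= c b by rewrite (le_trans _ (c1 b)).
(* e j separates the diagonal, the right and the left neighbour, with the
   weight 2 on the one that faces the boundary *)
pose e j : R := 2 * (i == j :> nat)%:R + c (i == 0 :> nat) * (i.+1 == j)%:R
  + c (i.+1 == m) * (j.+1 == i)%:R.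
have entry (j : 'I_m) : `|neumann1 m d i j| <= (d ^+ 2)^-1 * e j.
  rewrite !mxE normrM ger0_norm ?invr_ge0 ?sqr_ge0//.
  rewrite ler_wpM2l ?invr_ge0 ?sqr_ge0// /e -(inj_eq val_inj) /=.
  have right_ge0 : 0 <= c (i == 0 :> nat) * (i.+1 == j)%:R by rewrite mulr_ge0.
  have left_ge0 : 0 <= c (i.+1 == m) * (j.+1 == i)%:R by rewrite mulr_ge0.
  case: (eqVneq (i : nat) j) => [_|_].
    by rewrite normrN ger0_norm// mulr1; lra.
  rewrite mulr0 add0r.
  case: ifP => [/orP[/andP[/eqP i0 /eqP j1]|/andP[im jm]]|_].
  - by rewrite i0 j1 /= ger0_norm// /c !(mulr0, mulr1); lra.
  - have ji : (j.+1 == i) by rewrite -eqSS (eqP im).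
    by move: right_ge0; rewrite im ji /= ger0_norm// /c !(mulr0, mulr1); lra.
  have [i1 i2] := (c1 (i == 0 :> nat), c1 (i.+1 == m)).
  case: ifP => [|_]; last by rewrite normr0 addr_ge0.
  by case/orP=> ->; rewrite normr1 /= !(mulr0, mulr1); lra.
apply: le_trans (ler_sum _ (fun j _ => entry j)) _.
have S2 : \sum_(j < m) ((j.+1 == i)%:R : R) = (0 < i)%:R.
  case: i {c c0 c1 e entry} => -[|k] /= km; first by rewrite big1.
  under eq_bigr do rewrite eqSS eq_sym.
  by rewrite sum_ord_eqn (ltn_trans _ km).
rewrite -mulr_sumr [leRHS]mulrC ler_wpM2l ?invr_ge0 ?sqr_ge0//.
rewrite /e !big_split -!mulr_sumr /= S2 !sum_ord_eqn ltn_ord /c.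
case: (eqVneq (i.+1) m) => [->|_].
  rewrite ltnn; case: (i == 0 :> nat); case: (0 < i)%N;
    rewrite /= !(mulr0, mulr1); lra.
rewrite lt0n; case: (i == 0 :> nat); case: (i.+1 < m)%N;
  rewrite /= !(mulr0, mulr1); lra.
Qed.

Lemma sum_mxtens (R : nmodType) (m n : nat) (F : 'I_(m * n) -> R) :
  \sum_q F q = \sum_j \sum_i F (mxtens_index (j, i)).
Proof.
rewrite pair_bigA /= (reindex (@mxtens_index m n)) /=; last first.
  exists (@mxtens_unindex m n) => ? _; first exact: mxtens_indexK.
  exact: mxtens_unindexK.
by apply: eq_bigr => -[].
Qed.

(** The total weight of the four neighbours of a node in the five-point
    stencil. *)
Definition neighbour_weight (R : realType) (Lx Ly : R) (mx my : nat) : R :=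
  2 / step Lx mx ^+ 2 + 2 / step Ly my ^+ 2.

Lemma neighbour_weight_ge0 (R : realType) (Lx Ly : R) (mx my : nat) :
  0 <= neighbour_weight Lx Ly mx my.
Proof. by rewrite addr_ge0// divr_ge0// sqr_ge0. Qed.

Lemma laplacian_diag (R : realType) (Lx Ly : R) (mx my : nat)
    (p : 'I_(my * mx)) :
  neumann_laplacian Lx Ly mx my p p = - neighbour_weight Lx Ly mx my.
Proof.
case: p / (mxtens_indexP p) => j i.
by rewrite mxE !tensmxE !neumann1_diag !mxE !eqxx mul1r mulr1 -opprD.
Qed.

(** The Kronecker sum couples a node only to nodes of its own grid row and
    grid column, so the two one-dimensional bounds add up. *)
Lemma laplacian_row_le (R : realType) (Lx Ly : R) (mx my : nat)
    (p : 'I_(my * mx)) :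
  \sum_q `|neumann_laplacian Lx Ly mx my p q|
    <= 2 * neighbour_weight Lx Ly mx my.
Proof.
case: p / (mxtens_indexP p) => j i; rewrite sum_mxtens.
have sum_delta n (k : 'I_n) : \sum_l `|(1%:M : 'M[R]_n) k l| = 1.
  rewrite (bigD1 k)//= big1 => [|l lk]; first by rewrite addr0 mxE eqxx normr1.
  by rewrite mxE eq_sym (negbTE lk) normr0.
have : \sum_j' \sum_i' `|neumann_laplacian Lx Ly mx my (mxtens_index (j, i))
                                                     (mxtens_index (j', i'))|
    <= \sum_j' \sum_i'
        (`|(1%:M : 'M[R]_my) j j'| * `|neumann1 mx (step Lx mx) i i'| +
         `|neumann1 my (step Ly my) j j'| * `|(1%:M : 'M[R]_mx) i i'|).
  apply: ler_sum => j' _; apply: ler_sum => i' _.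
  by rewrite mxE !tensmxE -!normrM ler_normD.
move=> /le_trans; apply.
under eq_bigr do rewrite big_split /= -!mulr_sumr sum_delta mulr1.
rewrite big_split /= -mulr_suml sum_delta mul1r.
have := neumann1_row_le (step Lx mx) i.
have := neumann1_row_le (step Ly my) j.
rewrite /neighbour_weight; lra.
Qed.

Lemma laplacian_offdiag_le (R : realType) (Lx Ly : R) (mx my : nat)
    (p : 'I_(my * mx)) :
  \sum_(q | q != p) `|neumann_laplacian Lx Ly mx my p q|
    <= neighbour_weight Lx Ly mx my.
Proof.
have := laplacian_row_le Lx Ly p; rewrite (bigD1 p)//= laplacian_diag normrN.
rewrite ger0_norm; first by lra.
exact: neighbour_weight_ge0.
Qed.

Lemma hole_row_le (R : realType) (Lx Ly : R) (mx my : nat)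
    (Theta : set (R * R)) (p : 'I_(my * mx)) :
  \sum_q `|hole_mx1 Lx Ly mx my Theta p q| <= neighbour_weight Lx Ly mx my.
Proof.
apply: le_trans (laplacian_offdiag_le Lx Ly p).
rewrite (bigD1 p)//= mxE; case: ifPn => [/andP[/set_mem pT /set_mem[_]] //|_].
rewrite normr0 add0r; apply: ler_sum => q _; rewrite mxE.
by case: ifP; rewrite ?normr0.
Qed.

(** * Convergence under the step-size restrictions *)

Lemma hole_iteration_converges (R : realType) (Lx Ly : R) (mx my : nat)
    (Theta : set (R * R)) (a b : R) :
  0 <= b -> b * neighbour_weight Lx Ly mx my < a ->
  iteration_converges (a *: 1%:M - b *: neumann_laplacian Lx Ly mx my)
    (- b *: hole_mx1 Lx Ly mx my Theta).
Proof.
move=> b0 bSa.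
have bS0 : 0 <= b * neighbour_weight Lx Ly mx my.
  by rewrite mulr_ge0// neighbour_weight_ge0.
have entry (M : 'M[R]_(my * mx)) p q :
    (a *: 1%:M - b *: M) p q = a * (p == q)%:R - b * M p q by rewrite !mxE.
apply: (@dominant_iteration_converges _ _ _ _ a
  (b * neighbour_weight Lx Ly mx my)) => // p.
  rewrite entry laplacian_diag eqxx mulr1 mulrN opprK.
  rewrite ger0_norm ?lerD2l; last by lra.
  apply: le_trans (ler_wpM2l b0 (laplacian_offdiag_le Lx Ly p)).
  rewrite mulr_sumr; apply: ler_sum => q qp.
  rewrite entry eq_sym (negbTE qp) mulr0 add0r normrN normrM.
  by rewrite [`|b|]ger0_norm.
apply: le_trans (ler_wpM2l b0 (hole_row_le Lx Ly Theta p)).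
rewrite mulr_sumr; apply: ler_sum => q _.
by rewrite mxE normrM normrN [`|b|]ger0_norm.
Qed.

Lemma step_gt0 (R : realType) (L : R) (m : nat) :
  0 < L -> (2 <= m)%N -> 0 < step L m.
Proof. by case: m => [|[|m]]// L0 _; rewrite divr_gt0. Qed.

Lemma neighbour_weight_le (R : realType) (Lx Ly : R) (mx my : nat) :
  0 < step Lx mx -> 0 < step Ly my ->
  neighbour_weight Lx Ly mx my
    <= 4 / Num.min (step Lx mx) (step Ly my) ^+ 2.
Proof.
move=> dx0 dy0; set h := Num.min _ _.
have h0 : 0 < h by rewrite lt_min dx0.
have le d : h <= d -> 2 / d ^+ 2 <= 2 / h ^+ 2.
  move=> hd; have d0 := lt_le_trans h0 hd.
  by rewrite ler_pM2l// lef_pV2 ?posrE ?exprn_gt0// lerXn2r// nnegrE ltW.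
have hx : h <= step Lx mx by rewrite ge_min lexx.
have hy : h <= step Ly my by rewrite ge_min lexx orbT.
have := le _ hx; have := le _ hy; rewrite /neighbour_weight; lra.
Qed.

(** 3 and 11 are the values that give 4 <= 1 + sqrt 41 and
    (sqrt 41 - 1) / 40 <= 1 / 4. *)
Lemma sqrt41_bounds (R : realType) :
  3 <= Num.sqrt 41 :> R /\ Num.sqrt 41 <= 11 :> R.
Proof.
have s0 : 0 <= Num.sqrt 41 :> R by exact: sqrtr_ge0.
have s2 : Num.sqrt 41 ^+ 2 = 41 :> R by rewrite sqr_sqrtr.
by split; nra.
Qed.

(** H stands for h^2.  Both alternatives bound dt D / (gam + w dt) by
    H / (1 + sqrt 41); under the first, w dt alone already dominates, whatever
    the size of dt. *)
Lemma reaction_step_small (R : realType) (gam w dt D H : R) :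
  0 < gam -> 0 < w -> 0 < dt -> 0 < D -> 0 < H ->
  H > (1 + Num.sqrt 41) * D / w \/
  dt < gam * (Num.sqrt 41 - 1) * H / (40 * D + 2 * w * H) ->
  dt * D * 4 < (gam + w * dt) * H.
Proof.
move=> gam0 w0 dt0 D0 H0; have [s3 s11] := sqrt41_bounds R.
have gH0 : 0 < gam * H by exact: mulr_gt0.
have wH0 : 0 < w * H by exact: mulr_gt0.
have wHdt0 : 0 < w * H * dt by exact: mulr_gt0.
case.
  rewrite ltr_pdivrMr// => Hw.
  have : 4 * D * dt < w * H * dt by rewrite ltr_pM2r//; nra.
  nra.
rewrite ltr_pdivlMr; last by lra.
nra.
Qed.

Lemma diffusion_step_small (R : realType) (gam dt D H : R) :
  0 < gam -> 0 < D -> 0 < H ->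
  dt < gam * (Num.sqrt 41 - 1) * H / (40 * D) -> dt * D * 4 < gam * H.
Proof.
move=> gam0 D0 H0; have [s3 s11] := sqrt41_bounds R.
have gH0 : 0 < gam * H by exact: mulr_gt0.
rewrite ltr_pdivlMr; last by lra.
nra.
Qed.

Lemma gamma_gt0 (R : realType) (meth : imex_method) : 0 < gamma R meth.
Proof. by case: meth => /=; lra. Qed.

Theorem theorem9 (R : realType) (Lx Ly : R) (mx my : nat)
    (Theta : set (R * R)) (Dphi Dc w dt : R) (meth : imex_method)
    (Lx_gt0 : 0 < Lx) (Ly_gt0 : 0 < Ly)
    (mx_ge2 : (2 <= mx)%N) (my_ge2 : (2 <= my)%N)
    (Theta_int : Theta `<=` interior (domain Lx Ly))
    (Theta_node : exists p : 'I_(my * mx), Theta (grid_node Lx Ly p))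
    (Dphi_gt0 : 0 < Dphi) (Dc_gt0 : 0 < Dc) (w_gt0 : 0 < w) (dt_gt0 : 0 < dt) :
  let dx := step Lx mx in
  let dy := step Ly my in
  let h := Num.min dx dy in
  let gam := gamma R meth in
  dt * Dphi / (gam + w * dt) * (1 / dx ^+ 2 + 1 / dy ^+ 2) < 1 ->
  dt * Dc / gam * (1 / dx ^+ 2 + 1 / dy ^+ 2) < 1 ->
  h ^+ 2 > (1 + Num.sqrt 41) * Dphi / w \/
  dt < gam * (Num.sqrt 41 - 1) * h ^+ 2 / (40 * Dphi + 2 * w * h ^+ 2) ->
  dt < gam * (Num.sqrt 41 - 1) * h ^+ 2 / (40 * Dc) ->
  imex_iterations_converge meth w dt Dphi Dc
    (neumann_laplacian Lx Ly mx my) (hole_mx1 Lx Ly mx my Theta).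
Proof.
move=> dx dy h gam _ _ phi_small c_small.
have dx0 : 0 < dx by exact: step_gt0.
have dy0 : 0 < dy by exact: step_gt0.
have h0 : 0 < h by rewrite lt_min dx0.
have h2 : 0 < h ^+ 2 by exact: exprn_gt0.
have gam0 : 0 < gam by exact: gamma_gt0.
have weight D a : 0 < D -> dt * D * 4 < a * h ^+ 2 ->
    dt * D * neighbour_weight Lx Ly mx my < a.
  move=> D0 small; apply: le_lt_trans (_ : dt * D * (4 / h ^+ 2) < a).
    by rewrite ler_wpM2l ?neighbour_weight_le// mulr_ge0// ltW.
  by rewrite mulrA ltr_pdivrMr.
have phi_weight := weight _ _ Dphi_gt0
  (reaction_step_small gam0 w_gt0 dt_gt0 Dphi_gt0 h2 phi_small).
have c_weight := weight _ _ Dc_gt0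
  (diffusion_step_small gam0 Dc_gt0 h2 c_small).
have dtDphi0 : 0 < dt * Dphi by exact: mulr_gt0.
have dtDc0 : 0 < dt * Dc by exact: mulr_gt0.
move: phi_weight c_weight; rewrite /gam => phi_weight c_weight.
clear gam gam0 phi_small c_small.
split; case: meth phi_weight c_weight => /= phi_weight c_weight.
- by apply: hole_iteration_converges => //; exact: ltW.
(* twice the Euler form, since 3 + 2 w dt = 2 (3 / 2 + w dt) *)
- by apply: hole_iteration_converges; rewrite -?[2 * dt * _]mulrA; lra.
- rewrite -[X in iteration_converges (X - _)]scale1r.
  by apply: hole_iteration_converges => //; exact: ltW.
- by apply: hole_iteration_converges; rewrite -?[2 * dt * _]mulrA; lra.
Qed.
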